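(* Let $\mathsf P$ be a finite poset and $\mathsf L=\mathsf O(\mathsf P)$ its lattice of down-sets. Let $i\colon\mathbf K_s(\mathbf{GrVect}(\mathsf P))\to\mathbf K(\mathbf{GrVect}(\mathsf P))$ be the inclusion functor and $\mathfrak L_{\mathbf K}\colon\mathbf K(\mathbf{GrVect}(\mathsf P))\to\mathbf K(\mathbf{FVect}(\mathsf L))$ the functor induced by $\mathfrak L$. There exist functors (Conley functors) (1) $\mathfrak F\colon\mathbf K(\mathbf{GrVect}(\mathsf P))\to\mathbf K_s(\mathbf{GrVect}(\mathsf P))$, inverse (as an equivalence of categories, up to natural isomorphism) to $i$, and (2) $\mathfrak G\colon\mathbf K(\mathbf{FVect}(\mathsf L))\to\mathbf K_s(\mathbf{GrVect}(\mathsf P))$, inverse (as an equivalence of categories, up to natural isomorphism) to $\mathfrak L_{\mathbf K}\circ i$, which take a $\mathsf P$-graded chain complex, respectively an $\mathsf L$-filtered chain complex, to a Conley complex for it.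
   Context: $\mathbb K$ is a field; vector spaces are finite-dimensional over $\mathbb K$. A $\mathsf P$-graded vector space is $V$ with idempotents $\pi^p$ ($p\in\mathsf P$), $\sum_p\pi^p=\mathrm{id}$, $\pi^p\pi^q=0$ for $p\neq q$; $V^p=\operatorname{im}\pi^p$. A linear map is $\mathsf P$-filtered if $\phi^{pq}:=\pi^p\phi\pi^q\neq0$ implies $p\leq q$. These form $\mathbf{GrVect}(\mathsf P)$. An $\mathsf L$-filtered vector space $(V,f)$ is a vector space with a lattice homomorphism (preserving $0,1$) $f\colon\mathsf L\to\mathsf{Sub}(V)$ into the lattice of subspaces (operations $\cap,+$); a linear map $\phi\colon(V,f)\to(W,g)$ is $\mathsf L$-filtered if $\phi(f(a))\subseteq g(a)$ for all $a\in\mathsf L$. These form $\mathbf{FVect}(\mathsf L)$. For these additive categories $\mathbf A$, $\mathbf{Ch}(\mathbf A)$ is the category of $\mathbb Z$-indexed chain complexes in $\mathbf A$ and chain maps in $\mathbf A$; its objects are called $\mathsf P$-graded, resp. $\mathsf L$-filtered, chain complexes. $\mathbf K(\mathbf A)$ is the homotopy category: same objects, morphisms are chain maps modulo chain homotopy, where homotopies consist of morphisms $\gamma_n\colon C_n\to C'_{n+1}$ of $\mathbf A$. A $\mathsf P$-graded chain complex is strict if $\partial_n^{pp}=0$ for all $n,p$; $\mathbf K_s(\mathbf{GrVect}(\mathsf P))$ is the full subcategory of $\mathbf K(\mathbf{GrVect}(\mathsf P))$ on strict objects. $\mathfrak L\colon\mathbf{GrVect}(\mathsf P)\to\mathbf{FVect}(\mathsf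 O(\mathsf P))$ sends $(V,\pi)$ to $V$ with $f(a)=V^a=\bigoplus_{p\in a}V^p$ and is the identity on morphisms; it induces functors on chain complexes and on homotopy categories. A Conley complex for a $\mathsf P$-graded chain complex $(C,\pi)$ is a strict $\mathsf P$-graded chain complex isomorphic to $(C,\pi)$ in $\mathbf K(\mathbf{GrVect}(\mathsf P))$. A Conley complex for an $\mathsf L$-filtered chain complex $(C,f)$ is a strict $\mathsf P$-graded chain complex $(C',\pi)$ such that $\mathfrak L(C',\pi)$ is isomorphic to $(C,f)$ in $\mathbf K(\mathbf{FVect}(\mathsf L))$. *)

(* Defs.v *)
From HB Require Import structures.
From mathcomp Require Import all_boot all_order all_algebra.

Set Implicit Arguments.
Unset Strict Implicit.
Unset Printing Implicit Defensive.

Import Order.TTheory GRing.Theory.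
Local Open Scope ring_scope.

(** Hom-sets are setoids: two morphisms [f], [g] represent the same morphism when
  [eqv f g]. This is how "morphisms modulo homotopy" is expressed below. *)

Record category := Category {
  obj :> Type;
  hom : obj -> obj -> Type;
  eqv : forall x y, hom x y -> hom x y -> Prop;
  idm : forall x, hom x x;
  comp : forall x y z, hom y z -> hom x y -> hom x z;
  eqv_refl : forall x y (f : hom x y), eqv f f;
  eqv_sym : forall x y (f g : hom x y), eqv f g -> eqv g f;
  eqv_trans : forall x y (f g h : hom x y), eqv f g -> eqv g h -> eqv f h;
  comp_eqv : forall x y z (g g' : hom y z) (f f' : hom x y),
    eqv g g' -> eqv f f' -> eqv (comp g f) (comp g' f');
  comp_idl : forall x y (f : hom x y), eqv (comp (idm y) f) f;
  comp_idr : forall x y (f : hom x y), eqv (comp f (idm x)) f;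
  comp_assoc : forall w x y z (h : hom y z) (g : hom x y) (f : hom w x),
    eqv (comp h (comp g f)) (comp (comp h g) f) }.

Arguments hom {c} x y.
Arguments eqv {c x y} f g.
Arguments idm {c} x.
Arguments comp {c x y z} g f.

Definition is_iso (C : category) (x y : C) (f : hom x y) : Prop :=
  exists g : hom y x, eqv (comp g f) (idm x) /\ eqv (comp f g) (idm y).

Definition isomorphic (C : category) (x y : C) : Prop :=
  exists f : hom x y, is_iso f.

Record functor (C D : category) := Functor {
  fobj :> C -> D;
  fmap : forall x y : C, hom x y -> hom (fobj x) (fobj y);
  fmap_eqv : forall (x y : C) (f g : hom x y), eqv f g -> eqv (fmap f) (fmap g);
  fmap_id : forall x : C, eqv (fmap (idm x)) (idm (fobj x));
  fmap_comp : forall (x y z : C) (g : hom y z) (f : hom x y),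
    eqv (fmap (comp g f)) (comp (fmap g) (fmap f)) }.

Arguments fmap {C D} f0 {x y} f.

Definition functor_id (C : category) : functor C C.
Proof.
by exists (fun x => x) (fun x y f => f) => *; [|exact: eqv_refl|exact: eqv_refl].
Defined.

Definition functor_comp (C D E : category)
  (G : functor D E) (F : functor C D) : functor C E.
Proof.
exists (fun x => G (F x)) (fun x y f => fmap G (fmap F f)).
- by move=> x y f g fg; do 2 apply: fmap_eqv.
- by move=> x; apply: eqv_trans (fmap_id G _); apply/fmap_eqv/fmap_id.
- by move=> x y z g f; apply: eqv_trans (fmap_comp G _ _);
    apply/fmap_eqv/fmap_comp.
Defined.

Definition naturally_isomorphic (C D : category) (F G : functor C D) : Prop :=
  exists eta : forall x : C, hom (F x) (G x),
    (forall x, is_iso (eta x)) /\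
    (forall (x y : C) (f : hom x y),
       eqv (comp (eta y) (fmap F f)) (comp (fmap G f) (eta x))).

Definition inverse_equivalences (C D : category)
    (F : functor C D) (G : functor D C) : Prop :=
  naturally_isomorphic (functor_comp G F) (functor_id C) /\
  naturally_isomorphic (functor_comp F G) (functor_id D).

Section FullSubcategory.
Variables (C : category) (S : C -> Prop).

Definition full_subcategory : category.
Proof.
exists {x : C | S x} (fun x y => hom (sval x) (sval y)) (fun x y f g => eqv f g)
  (fun x => idm (sval x)) (fun x y z g f => comp g f).
- by move=> *; apply: eqv_refl.
- by move=> *; apply: eqv_sym.
- by move=> x y f g h; apply: eqv_trans.
- by move=> *; apply: comp_eqv.
- by move=> *; apply: comp_idl.
- by move=> *; apply: comp_idr.
- by move=> *; apply: comp_assoc.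
Defined.

Definition inclusion : functor full_subcategory C.
Proof.
exists (fun x : full_subcategory => sval x) (fun x y f => f) => //.
- by move=> *; apply: eqv_refl.
- by move=> *; apply: eqv_refl.
Defined.

End FullSubcategory.

(** Only the enrichment in abelian groups is needed to form chain complexes, chain
  maps and chain homotopies. *)

Record preadditive := Preadditive {
  aobj :> Type;
  ahom : aobj -> aobj -> zmodType;
  aidm : forall x, ahom x x;
  acomp : forall x y z, ahom y z -> ahom x y -> ahom x z;
  acomp_idl : forall x y (f : ahom x y), acomp (aidm y) f = f;
  acomp_idr : forall x y (f : ahom x y), acomp f (aidm x) = f;
  acomp_assoc : forall w x y z (h : ahom y z) (g : ahom x y) (f : ahom w x),
    acomp h (acomp g f) = acomp (acomp h g) f;
  acompDl : forall x y z (g g' : ahom y z) (f : ahom x y),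
    acomp (g + g') f = acomp g f + acomp g' f;
  acompDr : forall x y z (g : ahom y z) (f f' : ahom x y),
    acomp g (f + f') = acomp g f + acomp g f' }.

Arguments ahom {p} x y.
Arguments aidm {p} x.
Arguments acomp {p x y z} g f.

Record additive_functor (A B : preadditive) := AdditiveFunctor {
  afobj :> A -> B;
  afmap : forall x y : A, ahom x y -> ahom (afobj x) (afobj y);
  afmap_id : forall x : A, afmap (aidm x) = aidm (afobj x);
  afmap_comp : forall (x y z : A) (g : ahom y z) (f : ahom x y),
    afmap (acomp g f) = acomp (afmap g) (afmap f);
  afmapD : forall (x y : A) (f g : ahom x y),
    afmap (f + g) = afmap f + afmap g }.

Arguments afmap {A B} a {x y} f.

Section PreadditiveTheory.
Variable A : preadditive.

Lemma acomp0l (x y z : A) (f : ahom x y) : acomp (0 : ahom y z) f = 0.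
Proof. by apply: (addrI (acomp 0 f)); rewrite -acompDl !addr0. Qed.

Lemma acomp0r (x y z : A) (g : ahom y z) : acomp g (0 : ahom x y) = 0.
Proof. by apply: (addrI (acomp g 0)); rewrite -acompDr !addr0. Qed.

Lemma acompNl (x y z : A) (g : ahom y z) (f : ahom x y) :
  acomp (- g) f = - acomp g f.
Proof. by apply: (addrI (acomp g f)); rewrite -acompDl !subrr acomp0l. Qed.

Lemma acompNr (x y z : A) (g : ahom y z) (f : ahom x y) :
  acomp g (- f) = - acomp g f.
Proof. by apply: (addrI (acomp g f)); rewrite -acompDr !subrr acomp0r. Qed.

Lemma acompBl (x y z : A) (g g' : ahom y z) (f : ahom x y) :
  acomp (g - g') f = acomp g f - acomp g' f.
Proof. by rewrite acompDl acompNl. Qed.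

Lemma acompBr (x y z : A) (g : ahom y z) (f f' : ahom x y) :
  acomp g (f - f') = acomp g f - acomp g f'.
Proof. by rewrite acompDr acompNr. Qed.

End PreadditiveTheory.

Section AdditiveFunctorTheory.
Variables (A B : preadditive) (F : additive_functor A B).

Lemma afmap0 (x y : A) : afmap F (0 : ahom x y) = 0.
Proof. by apply: (addrI (afmap F 0)); rewrite -afmapD !addr0. Qed.

Lemma afmapN (x y : A) (f : ahom x y) : afmap F (- f) = - afmap F f.
Proof. by apply: (addrI (afmap F f)); rewrite -afmapD !subrr afmap0. Qed.

Lemma afmapB (x y : A) (f g : ahom x y) :
  afmap F (f - g) = afmap F f - afmap F g.
Proof. by rewrite afmapD afmapN. Qed.

End AdditiveFunctorTheory.

Section HomotopyCategory.
Variable A : preadditive.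

(** The boundary operators are indexed by their target: [bnd C n] is the map
    usually written [∂_(n+1)], from [C_(n+1)] to [C_n]. As [n] ranges over all
    integers this is only a reindexing, and it avoids transporting along
    [n - 1 + 1 = n]. Identities in degree [n] are accordingly stated in degree
    [n + 1]. *)
Record chain_complex := ChainComplex {
  chain :> int -> A;
  bnd : forall n : int, ahom (chain (n + 1)) (chain n);
  bnd_bnd : forall n : int, acomp (bnd n) (bnd (n + 1)) = 0 }.

Record chain_map (C D : chain_complex) := ChainMap {
  cmap :> forall n : int, ahom (C n) (D n);
  cmap_bnd : forall n : int,
    acomp (cmap n) (bnd C n) = acomp (bnd D n) (cmap (n + 1)) }.

Definition homotopic (C D : chain_complex) (f g : chain_map C D) : Prop :=
  exists gamma : forall n : int, ahom (C n) (D (n + 1)),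
  forall n : int,
    f (n + 1) - g (n + 1) =
      acomp (bnd D (n + 1)) (gamma (n + 1)) + acomp (gamma n) (bnd C n).

Definition chain_id (C : chain_complex) : chain_map C C.
Proof.
by exists (fun n => aidm (C n)) => n; rewrite acomp_idl acomp_idr.
Defined.

Definition chain_comp (C D E : chain_complex)
  (g : chain_map D E) (f : chain_map C D) : chain_map C E.
Proof.
exists (fun n => acomp (g n) (f n)) => n.
by rewrite -acomp_assoc cmap_bnd !acomp_assoc cmap_bnd.
Defined.

Lemma homotopic_eq (C D : chain_complex) (f g : chain_map C D) :
  (forall n, f n = g n) -> homotopic f g.
Proof.
move=> fg; exists (fun n => 0) => n.
by rewrite fg subrr acomp0l acomp0r addr0.
Qed.

Lemma homotopic_sym (C D : chain_complex) (f g : chain_map C D) :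
  homotopic f g -> homotopic g f.
Proof.
move=> [s hs]; exists (fun n => - s n) => n.
by rewrite acompNl acompNr -opprD -hs opprB.
Qed.

Lemma homotopic_trans (C D : chain_complex) (f g h : chain_map C D) :
  homotopic f g -> homotopic g h -> homotopic f h.
Proof.
move=> [s hs] [t ht]; exists (fun n => s n + t n) => n.
by rewrite acompDl acompDr addrACA -hs -ht addrA subrK.
Qed.

Lemma homotopic_comp (C D E : chain_complex)
    (g g' : chain_map D E) (f f' : chain_map C D) :
  homotopic g g' -> homotopic f f' ->
  homotopic (chain_comp g f) (chain_comp g' f').
Proof.
move=> [t ht] [s hs]; apply: (@homotopic_trans _ _ _ (chain_comp g f')).
  exists (fun n => acomp (g (n + 1)) (s n)) => n /=.
  rewrite -acompBr hs acompDr !acomp_assoc; congr (acomp _ _ + _).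
  exact: cmap_bnd.
exists (fun n => acomp (t n) (f' n)) => n /=.
by rewrite -acompBl ht acompDl -!acomp_assoc cmap_bnd.
Qed.

Definition K_cat : category.
Proof.
exists chain_complex chain_map homotopic chain_id chain_comp.
- by move=> C D f; apply: homotopic_eq.
- exact: homotopic_sym.
- exact: homotopic_trans.
- exact: homotopic_comp.
- by move=> C D f; apply: homotopic_eq => n /=; rewrite acomp_idl.
- by move=> C D f; apply: homotopic_eq => n /=; rewrite acomp_idr.
- by move=> C D E F h g f; apply: homotopic_eq => n /=; rewrite acomp_assoc.
Defined.

End HomotopyCategory.

Section InducedFunctor.
Variables (A B : preadditive) (F : additive_functor A B).

Definition chain_complex_fobj (C : chain_complex A) : chain_complex B.
Proof.
exists (fun n => F (C n)) (fun n => afmap F (bnd C n)) => n.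
by rewrite -afmap_comp bnd_bnd afmap0.
Defined.

Definition chain_complex_fmap (C D : chain_complex A) (f : chain_map C D) :
  chain_map (chain_complex_fobj C) (chain_complex_fobj D).
Proof.
exists (fun n => afmap F (f n)) => n /=.
by rewrite -!afmap_comp cmap_bnd.
Defined.

Definition K_functor : functor (K_cat A) (K_cat B).
Proof.
exists (chain_complex_fobj : K_cat A -> K_cat B) chain_complex_fmap.
- move=> C D f g [s hs]; exists (fun n => afmap F (s n)) => n /=.
  by rewrite -afmapB hs afmapD !afmap_comp.
- by move=> C; apply: homotopic_eq => n /=; rewrite afmap_id.
- by move=> C D E g f; apply: homotopic_eq => n /=; rewrite afmap_comp.
Defined.

End InducedFunctor.

Section DownSets.
Context {d : Order.disp_t} (P : finPOrderType d).

Definition is_downset (a : {set P}) : bool :=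
  [forall q in a, forall p, (p <= q)%O ==> (p \in a)].

Lemma is_downsetP (a : {set P}) :
  reflect (forall p q, q \in a -> (p <= q)%O -> p \in a) (is_downset a).
Proof.
apply: (iffP forall_inP) => [h p q qa pq | h q qa].
  by move/forallP/(_ p)/implyP: (h q qa); apply.
by apply/forallP => p; apply/implyP; apply: h.
Qed.

Record downset := DownSet { dset :> {set P}; dsetP : is_downset dset }.

HB.instance Definition _ := [isSub for dset].
HB.instance Definition _ := [Finite of downset by <:].

Lemma downset0_subproof : is_downset set0.
Proof. by apply/is_downsetP => p q; rewrite inE. Qed.

Lemma downsetT_subproof : is_downset setT.
Proof. by apply/is_downsetP => p q; rewrite !inE. Qed.

Lemma downsetI_subproof (a b : downset) : is_downset (a :&: b).
Proof.
apply/is_downsetP => p q; rewrite !inE => /andP[qa qb] pq.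
by rewrite (is_downsetP _ (dsetP a) _ _ qa pq) (is_downsetP _ (dsetP b) _ _ qb pq).
Qed.

Lemma downsetU_subproof (a b : downset) : is_downset (a :|: b).
Proof.
apply/is_downsetP => p q; rewrite !inE => /orP[qa|qb] pq.
  by rewrite (is_downsetP _ (dsetP a) _ _ qa pq).
by rewrite (is_downsetP _ (dsetP b) _ _ qb pq) orbT.
Qed.

Definition downset_le (a b : downset) : bool := a \subset b.
Definition downset0 : downset := DownSet downset0_subproof.
Definition downsetT : downset := DownSet downsetT_subproof.
Definition downsetI (a b : downset) : downset := DownSet (downsetI_subproof a b).
Definition downsetU (a b : downset) : downset := DownSet (downsetU_subproof a b).

Fact downset_display : Order.disp_t. Proof. exact: (Order.Disp tt tt). Qed.

Lemma downset_le_def a b : downset_le a b = (downsetI a b == a).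
Proof. by rewrite -val_eqE; apply/setIidPl/eqP. Qed.

Lemma downsetIC : commutative downsetI.
Proof. by move=> a b; apply: val_inj; rewrite /= setIC. Qed.

Lemma downsetUC : commutative downsetU.
Proof. by move=> a b; apply: val_inj; rewrite /= setUC. Qed.

Lemma downsetIA : associative downsetI.
Proof. by move=> a b c; apply: val_inj; rewrite /= setIA. Qed.

Lemma downsetUA : associative downsetU.
Proof. by move=> a b c; apply: val_inj; rewrite /= setUA. Qed.

Lemma downsetUKI b a : downsetI a (downsetU a b) = a.
Proof. by apply: val_inj; rewrite /= setUC setKU. Qed.

Lemma downsetIKU b a : downsetU a (downsetI a b) = a.
Proof. by apply: val_inj; rewrite /= setIC setKI. Qed.

Lemma downsetIUl : left_distributive downsetI downsetU.
Proof. by move=> a b c; apply: val_inj; rewrite /= setIUl. Qed.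

Lemma downsetII : idempotent_op downsetI.
Proof. by move=> a; apply: val_inj; rewrite /= setIid. Qed.

HB.instance Definition _ :=
  Order.isMeetJoinDistrLattice.Build downset_display downset
    downset_le_def (fun _ _ => erefl) downsetIC downsetUC downsetIA downsetUA
    downsetUKI downsetIKU downsetIUl downsetII.

Lemma downset_le0 (a : downset) : (downset0 <= a)%O.
Proof. exact: sub0set. Qed.

Lemma downset_leT (a : downset) : (a <= downsetT)%O.
Proof. exact: subsetT. Qed.

HB.instance Definition _ := Order.hasBottom.Build downset_display downset downset_le0.
HB.instance Definition _ := Order.hasTop.Build downset_display downset downset_leT.

End DownSets.

Section GradedVectorSpaces.
Context {d : Order.disp_t} (P : finPOrderType d) (K : fieldType).

(** [gr_proj_idem] follows from the two other conditions; it is kept as part of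
    the usual description of a grading by projections. *)
Record graded_vect := GradedVect {
  gr_space :> vectType K;
  gr_proj : P -> 'End(gr_space);
  gr_proj_idem : forall p, (gr_proj p \o gr_proj p)%VF = gr_proj p;
  gr_proj_orth : forall p q, p != q -> (gr_proj p \o gr_proj q)%VF = 0;
  gr_proj_sum : \sum_p gr_proj p = \1%VF }.

Arguments gr_proj : clear implicits.


Definition gr_entry (V W : graded_vect) (phi : 'Hom(V, W)) (p q : P) :
  'Hom(V, W) := (gr_proj W p \o (phi \o gr_proj V q))%VF.

Definition gr_filtered (V W : graded_vect) : {pred 'Hom(V, W)} :=
  fun phi => [forall p, forall q, (gr_entry phi p q != 0) ==> (p <= q)%O].

Arguments gr_filtered : clear implicits.

Lemma gr_filteredP (V W : graded_vect) (phi : 'Hom(V, W)) :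
  reflect (forall p q, ~~ (p <= q)%O -> gr_entry phi p q = 0)
          (phi \in gr_filtered V W).
Proof.
apply: (iffP forallP) => [h p q npq | h p].
  by apply/eqP; apply: contraR npq => nz; move/forallP/(_ q): (h p); rewrite nz.
by apply/forallP => q; apply/implyP; apply: contraR => npq; rewrite h.
Qed.

Lemma gr_filtered_zmod_closed (V W : graded_vect) :
  zmod_closed (gr_filtered V W).
Proof.
split=> [|f g /gr_filteredP hf /gr_filteredP hg]; apply/gr_filteredP => p q npq.
  by rewrite /gr_entry comp_lfun0l comp_lfun0r.
rewrite /gr_entry comp_lfunDl comp_lfunDr comp_lfunNl comp_lfunNr.
by move: (hf p q npq) (hg p q npq); rewrite /gr_entry => -> ->; rewrite subrr.
Qed.

HB.instance Definition _ (V W : graded_vect) :=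
  GRing.isZmodClosed.Build 'Hom(V, W) (gr_filtered V W)
    (gr_filtered_zmod_closed V W).

Record gr_hom (V W : graded_vect) := GrHom {
  gr_fun :> 'Hom(V, W);
  gr_funP : gr_fun \in gr_filtered V W }.

HB.instance Definition _ (V W : graded_vect) := [isSub for @gr_fun V W].
HB.instance Definition _ (V W : graded_vect) := [Choice of gr_hom V W by <:].
HB.instance Definition _ (V W : graded_vect) :=
  [SubChoice_isSubZmodule of gr_hom V W by <:].

Lemma gr_id_subproof (V : graded_vect) : \1%VF \in gr_filtered V V.
Proof.
apply/gr_filteredP => p q npq; rewrite /gr_entry comp_lfun1l gr_proj_orth //.
by apply: contraNneq npq => ->.
Qed.

Lemma gr_entry_comp (U V W : graded_vect) (g : 'Hom(V, W)) (f : 'Hom(U, V)) p q :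
  gr_entry (g \o f)%VF p q = \sum_r (gr_entry g p r \o gr_entry f r q)%VF.
Proof.
apply/lfunP => v; rewrite /gr_entry sum_lfunE !comp_lfunE.
rewrite -[f _]id_lfunE -(gr_proj_sum V) sum_lfunE !linear_sum.
apply: eq_bigr => r _; rewrite !comp_lfunE.
by rewrite -[in LHS](@gr_proj_idem V r) comp_lfunE.
Qed.

Lemma gr_comp_subproof (U V W : graded_vect) (g : gr_hom V W) (f : gr_hom U V) :
  (g \o f)%VF \in gr_filtered U W.
Proof.
apply/gr_filteredP => p q npq; rewrite gr_entry_comp big1 // => r _.
have [pr|npr] := boolP (p <= r)%O; last first.
  by rewrite (gr_filteredP _ (gr_funP g)) // comp_lfun0l.
rewrite (gr_filteredP _ (gr_funP f)) ?comp_lfun0r //.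
by apply: contra npq; apply: le_trans.
Qed.

Definition gr_id (V : graded_vect) : gr_hom V V := GrHom (gr_id_subproof V).
Definition gr_comp (U V W : graded_vect) (g : gr_hom V W) (f : gr_hom U V) :
  gr_hom U W := GrHom (gr_comp_subproof g f).

Definition GrVect : preadditive.
Proof.
exists graded_vect (fun V W => gr_hom V W : zmodType) gr_id gr_comp.
- by move=> V W f; apply: val_inj; rewrite /= comp_lfun1l.
- by move=> V W f; apply: val_inj; rewrite /= comp_lfun1r.
- by move=> U V W X h g f; apply: val_inj; rewrite /= comp_lfunA.
- by move=> U V W g g' f; apply: val_inj; rewrite /= comp_lfunDl.
- by move=> U V W g f f'; apply: val_inj; rewrite /= comp_lfunDr.
Defined.

End GradedVectorSpaces.

Arguments gr_proj {d P K} V p : rename.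
Arguments gr_filtered {d P K} V W.

Section FilteredVectorSpaces.
Context {d : Order.disp_t} (L : finTBDistrLatticeType d) (K : fieldType).

Record filtered_vect := FilteredVect {
  fl_space :> vectType K;
  fl_filt : L -> {vspace fl_space};
  fl_filt_bot : fl_filt \bot%O = 0%VS;
  fl_filt_top : fl_filt \top%O = fullv;
  fl_filt_meet : forall a b, fl_filt (a `&` b)%O = (fl_filt a :&: fl_filt b)%VS;
  fl_filt_join : forall a b, fl_filt (a `|` b)%O = (fl_filt a + fl_filt b)%VS }.

Arguments fl_filt : clear implicits.


Definition fl_filtered (V W : filtered_vect) : {pred 'Hom(V, W)} :=
  fun phi => [forall a : L, (phi @: fl_filt V a <= fl_filt W a)%VS].

Arguments fl_filtered : clear implicits.

Lemma fl_filteredP (V W : filtered_vect) (phi : 'Hom(V, W)) :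
  reflect (forall a v, v \in fl_filt V a -> phi v \in fl_filt W a)
          (phi \in fl_filtered V W).
Proof.
apply: (iffP forallP) => [h a v va | h a].
  by apply: (subvP (h a)); apply: memv_img.
by apply/subvP => _ /memv_imgP[v va ->]; apply: h.
Qed.

Lemma fl_filtered_zmod_closed (V W : filtered_vect) :
  zmod_closed (fl_filtered V W).
Proof.
split=> [|f g /fl_filteredP hf /fl_filteredP hg]; apply/fl_filteredP => a v va.
  by rewrite zero_lfunE mem0v.
by rewrite add_lfunE opp_lfunE memvB ?hf ?hg.
Qed.

HB.instance Definition _ (V W : filtered_vect) :=
  GRing.isZmodClosed.Build 'Hom(V, W) (fl_filtered V W)
    (fl_filtered_zmod_closed V W).

Record fl_hom (V W : filtered_vect) := FlHom {
  fl_fun :> 'Hom(V, W);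
  fl_funP : fl_fun \in fl_filtered V W }.

HB.instance Definition _ (V W : filtered_vect) := [isSub for @fl_fun V W].
HB.instance Definition _ (V W : filtered_vect) := [Choice of fl_hom V W by <:].
HB.instance Definition _ (V W : filtered_vect) :=
  [SubChoice_isSubZmodule of fl_hom V W by <:].

Lemma fl_id_subproof (V : filtered_vect) : \1%VF \in fl_filtered V V.
Proof. by apply/fl_filteredP => a v; rewrite id_lfunE. Qed.

Lemma fl_comp_subproof (U V W : filtered_vect) (g : fl_hom V W) (f : fl_hom U V) :
  (g \o f)%VF \in fl_filtered U W.
Proof.
apply/fl_filteredP => a v va; rewrite comp_lfunE.
by apply: (fl_filteredP _ (fl_funP g)); apply: (fl_filteredP _ (fl_funP f)).
Qed.

Definition fl_id (V : filtered_vect) : fl_hom V V := FlHom (fl_id_subproof V).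
Definition fl_comp (U V W : filtered_vect) (g : fl_hom V W) (f : fl_hom U V) :
  fl_hom U W := FlHom (fl_comp_subproof g f).

Definition FVect : preadditive.
Proof.
exists filtered_vect (fun V W => fl_hom V W : zmodType) fl_id fl_comp.
- by move=> V W f; apply: val_inj; rewrite /= comp_lfun1l.
- by move=> V W f; apply: val_inj; rewrite /= comp_lfun1r.
- by move=> U V W X h g f; apply: val_inj; rewrite /= comp_lfunA.
- by move=> U V W g g' f; apply: val_inj; rewrite /= comp_lfunDl.
- by move=> U V W g f f'; apply: val_inj; rewrite /= comp_lfunDr.
Defined.

End FilteredVectorSpaces.

Arguments fl_filt {d L K} V a : rename.
Arguments fl_filtered {d L K} V W.

Section GradedToFiltered.
Context {d : Order.disp_t} (P : finPOrderType d) (K : fieldType).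

(** The sum is direct, since the projections are orthogonal idempotents. *)
Definition gr_sum (V : graded_vect P K) (a : downset P) : {vspace V} :=
  (\sum_(p in dset a) limg (gr_proj V p))%VS.

Lemma gr_projE (V : graded_vect P K) p q (v : V) :
  gr_proj V p (gr_proj V q v) = if p == q then gr_proj V p v else 0.
Proof.
rewrite -comp_lfunE; case: eqVneq => [->|npq]; first by rewrite gr_proj_idem.
by rewrite gr_proj_orth // zero_lfunE.
Qed.

Lemma gr_sumP (V : graded_vect P K) (a : downset P) (v : V) :
  reflect (forall p, p \notin dset a -> gr_proj V p v = 0) (v \in gr_sum V a).
Proof.
apply: (iffP idP) => [/memv_sumP[u hu ->] p pa | h].
  rewrite linear_sum big1 // => q qa.
  have /memv_imgP[w _ ->] := hu q qa.
  by rewrite /= gr_projE; case: eqVneq => // epq; rewrite epq qa in pa.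
rewrite -[v]id_lfunE -(gr_proj_sum V) sum_lfunE (bigID (mem (dset a))) /=.
rewrite [X in _ + X]big1 ?addr0 //.
by apply: memv_sumr => p pa; apply: memv_img; apply: memvf.
Qed.

Definition gr_to_fl_obj (V : graded_vect P K) : filtered_vect (downset P) K.
Proof.
exists V (gr_sum V).
- by rewrite /gr_sum big_pred0 // => p; rewrite inE.
- apply/eqP; rewrite eqEsubv subvf; apply/subvP => v _.
  by apply/gr_sumP => p; rewrite inE.
- move=> a b; apply/vspaceP => v; rewrite memv_cap.
  apply/gr_sumP/andP => [h|[/gr_sumP ha /gr_sumP hb] p].
    by split; apply/gr_sumP => p pa; apply: h; rewrite inE negb_and pa ?orbT.
  by rewrite inE negb_and => /orP[/ha|/hb].
- move=> a b; apply: subv_anti; apply/andP; split.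
    apply/subv_sumP => p; rewrite inE => /orP[pa|pb].
      by apply: subv_trans (addvSl _ _); apply: sumv_sup pa _.
    by apply: subv_trans (addvSr _ _); apply: sumv_sup pb _.
  rewrite subv_add; apply/andP; split; apply/subv_sumP => p pa;
  by apply: (sumv_sup p) => //; rewrite inE pa ?orbT.
Defined.

Lemma gr_to_fl_subproof (V W : graded_vect P K) (phi : gr_hom V W) :
  (phi : 'Hom(gr_to_fl_obj V, gr_to_fl_obj W))
    \in fl_filtered (gr_to_fl_obj V) (gr_to_fl_obj W).
Proof.
apply/fl_filteredP => a v /gr_sumP va; apply/gr_sumP => p pa.
rewrite -[v]id_lfunE -(gr_proj_sum V) sum_lfunE !linear_sum big1 // => q _.
have [qa|/va ->] := boolP (q \in dset a); last by rewrite !linear0.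
have npq : ~~ (p <= q)%O.
  by apply: contra pa; apply: (is_downsetP _ (dsetP a)).
have /lfunP/(_ v) := gr_filteredP _ (gr_funP phi) p q npq.
by rewrite /gr_entry !comp_lfunE zero_lfunE.
Qed.

Definition gr_to_fl : additive_functor (GrVect P K) (FVect (downset P) K).
Proof.
exists (gr_to_fl_obj : GrVect P K -> FVect (downset P) K)
  (fun V W (phi : gr_hom V W) => FlHom (gr_to_fl_subproof phi)).
- by move=> V; apply: val_inj.
- by move=> U V W g f; apply: val_inj.
- by move=> V W f g; apply: val_inj.
Defined.

Definition gr_to_fl_K :
  functor (K_cat (GrVect P K)) (K_cat (FVect (downset P) K)) :=
  K_functor gr_to_fl.

(** [∂_(n+1)^(pp) = 0] for all [n], i.e. in every degree. *)
Definition strict (C : K_cat (GrVect P K)) : Prop :=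
  forall (n : int) (p : P),
    gr_entry (gr_fun (bnd C n)) p p = 0.

Definition Ks_GrVect : category := full_subcategory strict.

Definition Ks_inclusion : functor Ks_GrVect (K_cat (GrVect P K)) :=
  inclusion strict.

Definition gr_conley_complex
    (C : K_cat (GrVect P K)) (C' : Ks_GrVect) : Prop :=
  isomorphic (Ks_inclusion C') C.

Definition fl_conley_complex
    (C : K_cat (FVect (downset P) K)) (C' : Ks_GrVect) : Prop :=
  isomorphic (gr_to_fl_K (Ks_inclusion C')) C.

End GradedToFiltered.

(* Main.v *)
From Stdlib Require Import IndefiniteDescription Setoid Morphisms.
From mathcomp Require Import all_boot all_order all_algebra.
Require Import Defs.

(** Both claims are instances of one principle: a full, faithful and essentially
  surjective functor [F : C -> D] has an inverse equivalence [G], built by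
  choosing for each [y] an object [G y] and an isomorphism [F (G y) -> y]
  ([inverse_equivalence_exists]). For the functors at hand this isomorphism says
  precisely that [G y] is a Conley complex of [y]. The inclusion of the strict
  complexes is full and faithful by construction, so two things remain.

  First, the passage from gradings to filtrations is already an equivalence
  before taking complexes. A map preserving the subspaces of the principal
  down-sets is triangular, and a filtration [f] by down-sets is split by any
  choice of complements of [f {q | q < p}] in [f {q | q <= p}]: adding the
  elements of a down-set one at a time shows that [f a] is the direct sum of the
  complements indexed by [a] ([fl_filt_pieces]). Full faithfulness and essential
  surjectivity pass to homotopy categories degree by degree.

  Second, every graded complex [C] is homotopy equivalent to a strict one
  ([strict_representative]). Suppose that there are morphisms
  [gam_n : C_n -> C_(n+1)] with [gam d gam = gam] such that [d - d gam d] has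
  zero diagonal. Making [gam] square to zero turns it into a homotopy [h] for
  which [e = 1 - d h - h d] is an idempotent chain map, homotopic to the identity
  and with [d e = e d = d - d gam d]. Splitting [e] degreewise then gives a
  complex homotopy equivalent to [C], whose differential has zero diagonal
  because taking diagonal entries of triangular maps is multiplicative.
  Idempotents do split for filtered spaces, where the image of [e] carries the
  image filtration, hence they split for graded spaces by the first part.

  The morphism [gam] is found in each degree separately
  ([gr_quasi_inverse_mod_strict]). The diagonal part [d0] of [d] consists of
  linear maps between vector spaces, so it has a diagonal quasi-inverse [g]:
  [d0 g d0 = d0] and [g d0 g = g]. The endomorphism [u = 1 + (d - d0) g] has
  identity diagonal, hence is invertible, and [gam = g u^-1] is a quasi-inverse
  of the perturbed map [d] with the same diagonal as [g]. *)

Set Implicit Arguments.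
Unset Strict Implicit.
Unset Printing Implicit Defensive.

Import Order.TTheory GRing.Theory.
Local Open Scope ring_scope.

(** * Equivalences of categories with setoid hom-sets *)

Lemma dependent_choice (A : Type) (B : A -> Type) (R : forall x, B x -> Prop) :
  (forall x, exists y, R x y) -> exists f : forall x, B x, forall x, R x (f x).
Proof.
move=> h; pose c x := constructive_indefinite_description _ (h x).
by exists (fun x => sval (c x)) => x; case: (c x).
Qed.

Section SetoidCategories.

#[local] Instance eqv_equivalence (C : category) (x y : C) :
  Equivalence (@eqv C x y).
Proof.
split; [exact: eqv_refl | exact: eqv_sym | exact: eqv_trans].
Qed.

#[local] Instance comp_proper (C : category) (x y z : C) :
  Proper (@eqv C y z ==> @eqv C x y ==> @eqv C x z) (@comp C x y z).
Proof. by move=> g g' gg' f f' ff'; apply: comp_eqv. Qed.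

#[local] Instance fmap_proper (C D : category) (F : functor C D) (x y : C) :
  Proper (@eqv C x y ==> @eqv D (F x) (F y)) (@fmap C D F x y).
Proof. by move=> f g fg; apply: fmap_eqv. Qed.

#[local] Hint Resolve eqv_refl : core.

Definition full (C D : category) (F : functor C D) : Prop :=
  forall (x y : C) (g : hom (F x) (F y)), exists f, eqv (fmap F f) g.

Definition faithful (C D : category) (F : functor C D) : Prop :=
  forall (x y : C) (f g : hom x y), eqv (fmap F f) (fmap F g) -> eqv f g.

Definition essentially_surjective (C D : category) (F : functor C D) : Prop :=
  forall y : D, exists x : C, isomorphic (F x) y.

Lemma isomorphic_trans (C : category) (x y z : C) :
  isomorphic x y -> isomorphic y z -> isomorphic x z.
Proof.
move=> [f [f' [f'f ff']]] [g [g' [g'g gg']]].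
exists (comp g f), (comp f' g'); split.
  by rewrite comp_assoc -(comp_assoc f' g' g) g'g comp_idr.
by rewrite comp_assoc -(comp_assoc g f f') ff' comp_idr.
Qed.

Lemma fmap_isomorphic (C D : category) (F : functor C D) (x y : C) :
  isomorphic x y -> isomorphic (F x) (F y).
Proof.
move=> [f [g [gf fg]]]; exists (fmap F f), (fmap F g).
by split; rewrite -fmap_comp ?gf ?fg fmap_id.
Qed.

Lemma essentially_surjective_comp (C D E : category)
    (G : functor D E) (F : functor C D) :
  essentially_surjective F -> essentially_surjective G ->
  essentially_surjective (functor_comp G F).
Proof.
move=> hF hG z; have [y yz] := hG z; have [x xy] := hF y.
by exists x; apply: isomorphic_trans (fmap_isomorphic G xy) yz.
Qed.

Lemma full_comp (C D E : category) (G : functor D E) (F : functor C D) :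
  full F -> full G -> full (functor_comp G F).
Proof.
move=> hF hG x y k; have [g gk] := hG _ _ k; have [f fg] := hF _ _ g.
by exists f => /=; rewrite fg.
Qed.

Lemma faithful_comp (C D E : category) (G : functor D E) (F : functor C D) :
  faithful F -> faithful G -> faithful (functor_comp G F).
Proof. by move=> hF hG x y f g /hG /hF. Qed.

(** Objects, isomorphisms and preimages of morphisms are all chosen at once; the
  functor laws for [G], naturality and invertibility of the unit then follow by
  applying the faithful functor [F]. *)
Theorem inverse_equivalence_exists (C D : category) (F : functor C D) :
  full F -> faithful F -> essentially_surjective F ->
  exists G : functor D C,
    inverse_equivalences G F /\ (forall y, isomorphic (F (G y)) y).
Proof.
move=> fullF faithF /dependent_choice[g /dependent_choice[t]].
move=> /dependent_choice[s hst].
have st y : eqv (comp (s y) (t y)) (idm _) by case: (hst y).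
have ts y : eqv (comp (t y) (s y)) (idm _) by case: (hst y).
(* The preimages are chosen over the type of all triples of two objects and a
   morphism, so that a single choice function serves all hom-sets. *)
have /dependent_choice[l hl] (a : {xy : C * C & hom (F xy.1) (F xy.2)}) :
  exists f, eqv (fmap F f) (tagged a) by apply: fullF.
pose lift x y (k : hom (F x) (F y)) : hom x y :=
  l (existT (fun xy : C * C => hom (F xy.1) (F xy.2)) (x, y) k).
have liftK x y (k : hom (F x) (F y)) : eqv (fmap F (lift x y k)) k.
  exact: (hl (existT (fun xy : C * C => hom (F xy.1) (F xy.2)) (x, y) k)).
pose Gmap x y (f : hom x y) := lift _ _ (comp (s y) (comp f (t x))).
have G_eqv x y (f f' : hom x y) : eqv f f' -> eqv (Gmap x y f) (Gmap x y f').
  by move=> ff'; apply: faithF; rewrite !liftK ff'.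
have G_id x : eqv (Gmap x x (idm x)) (idm _).
  by apply: faithF; rewrite liftK fmap_id comp_idl st.
have G_comp x y z (f' : hom y z) (f : hom x y) :
    eqv (Gmap x z (comp f' f)) (comp (Gmap y z f') (Gmap x y f)).
  apply: faithF; rewrite fmap_comp !liftK !comp_assoc.
  by rewrite -(comp_assoc _ (t y) (s y)) ts comp_idr.
pose G := Functor G_eqv G_id G_comp.
exists G; split; last by move=> y; exists (t y), (s y); exact: hst.
split.
  exists t; split=> [y | x y f /=]; first by exists (s y); exact: hst.
  by rewrite liftK comp_assoc ts comp_idl.
exists (fun x => lift _ _ (t (F x))); split=> [x | x y f /=].
  exists (lift _ _ (s (F x))).
  by split; apply: faithF; rewrite fmap_comp fmap_id !liftK ?st ?ts.
apply: faithF; rewrite !fmap_comp !liftK.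
by rewrite comp_assoc ts comp_idl.
Qed.

Lemma inclusion_full (C : category) (S : C -> Prop) : full (inclusion S).
Proof. by move=> x y g; exists g; apply: eqv_refl. Qed.

Lemma inclusion_faithful (C : category) (S : C -> Prop) :
  faithful (inclusion S).
Proof. by []. Qed.

End SetoidCategories.

(** * Passing from an additive functor to homotopy categories *)

Section PreadditiveFunctors.
Variables (A B : preadditive) (F : additive_functor A B).

Definition afull : Prop :=
  forall (x y : A) (g : ahom (F x) (F y)), exists f, afmap F f = g.

Definition afaithful : Prop :=
  forall (x y : A) (f g : ahom x y), afmap F f = afmap F g -> f = g.

Definition aisomorphic (C : preadditive) (x y : C) : Prop :=
  exists (f : ahom x y) (g : ahom y x),
    acomp g f = aidm x /\ acomp f g = aidm y.

Definition aessentially_surjective : Prop :=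
  forall y : B, exists x : A, aisomorphic (F x) y.

Lemma K_functor_full : afull -> afaithful -> full (K_functor F).
Proof.
move=> fullF faithF C D g.
have /dependent_choice[f hf] n := fullF _ _ (g n).
have f_bnd n : acomp (f n) (bnd C n) = acomp (bnd D n) (f (n + 1)).
  by apply: faithF; rewrite !afmap_comp !hf; apply: (cmap_bnd g).
by exists (ChainMap f_bnd); apply: homotopic_eq => n /=.
Qed.

Lemma K_functor_faithful : afull -> afaithful -> faithful (K_functor F).
Proof.
move=> fullF faithF C D f g [s hs].
have /dependent_choice[t ht] n := fullF _ _ (s n).
exists t => n; apply: faithF.
by rewrite afmapB afmapD !afmap_comp !ht; apply: hs.
Qed.

(** A complex is transported along isomorphisms chosen degree by degree, with its
  boundary conjugated by them; these isomorphisms then form a chain isomorphism,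
  so no homotopy is involved. *)
Lemma K_functor_essentially_surjective :
  afull -> afaithful -> aessentially_surjective ->
  essentially_surjective (K_functor F).
Proof.
move=> fullF faithF esF D.
have /dependent_choice[X /dependent_choice[t]] n := esF (D n).
move=> /dependent_choice[s hst].
have st n : acomp (s n) (t n) = aidm _ by case: (hst n).
have ts n : acomp (t n) (s n) = aidm _ by case: (hst n).
have /dependent_choice[b hb] n :=
  fullF _ _ (acomp (s n) (acomp (bnd D n) (t (n + 1)))).
have bb n : acomp (b n) (b (n + 1)) = 0.
  apply: faithF; rewrite afmap_comp afmap0 !hb -!acomp_assoc.
  rewrite (acomp_assoc (t _) (s _)) ts acomp_idl.
  by rewrite (acomp_assoc (bnd D n)) bnd_bnd acomp0l acomp0r.
exists (ChainComplex bb).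
have t_bnd n : acomp (t n) (afmap F (b n)) = acomp (bnd D n) (t (n + 1)).
  by rewrite hb acomp_assoc ts acomp_idl.
have s_bnd n : acomp (s n) (bnd D n) = acomp (afmap F (b n)) (s (n + 1)).
  by rewrite hb -!acomp_assoc ts acomp_idr.
exists (ChainMap (C := K_functor F (ChainComplex bb)) (D := D) t_bnd).
exists (ChainMap (C := D) (D := K_functor F (ChainComplex bb)) s_bnd).
by split; apply: homotopic_eq => n /=.
Qed.

End PreadditiveFunctors.

(** * Reducing a complex along a degreewise quasi-inverse *)

Section IdempotentReduction.

(** The idempotent below involves the boundaries on both sides of a degree, which
  is only expressible in degrees written [n + 1]; this extends such a family to
  all integers. *)
Lemma shift_family (X : int -> Type) (f : forall n, X (n + 1)) :
  exists g : forall n, X n, forall n, g (n + 1) = f n.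
Proof.
exists (fun n => eq_rect (n - 1 + 1) X (f (n - 1)) n (subrK 1 n)) => n.
move: (addrK 1 n) (subrK 1 (n + 1)); move: (n + 1 - 1) => m -> e.
by rewrite (eq_axiomK e).
Qed.

Definition split_idempotent (A : preadditive) (x : A) (e : ahom x x) : Prop :=
  exists (y : A) (r : ahom x y) (s : ahom y x),
    acomp r s = aidm y /\ acomp s r = e.

Definition idempotents_split (A : preadditive) : Prop :=
  forall (x : A) (e : ahom x x), acomp e e = e -> split_idempotent e.

Lemma idempotents_split_reflect (A B : preadditive) (F : additive_functor A B) :
  afull F -> afaithful F -> aessentially_surjective F ->
  idempotents_split B -> idempotents_split A.
Proof.
move=> fullF faithF esF hB x e ee.
have [|y [r [s [rs sr]]]] := hB _ (afmap F e); first by rewrite -afmap_comp ee.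
have [z [t [u [ut tu]]]] := esF y.
have [r' hr'] := fullF _ _ (acomp u r).
have [s' hs'] := fullF _ _ (acomp s t).
exists z, r', s'; split; apply: faithF; rewrite afmap_comp hr' hs'.
  by rewrite acomp_assoc -(acomp_assoc u r s) rs acomp_idr ut afmap_id.
by rewrite acomp_assoc -(acomp_assoc s t u) tu acomp_idr.
Qed.

Variable A : preadditive.

Section Reduction.
Variables (C : chain_complex A) (gam : forall n, ahom (C n) (C (n + 1))).
Hypothesis gam_quasi :
  forall n, acomp (gam n) (acomp (bnd C n) (gam n)) = gam n.

Let d := bnd C.
(* [h] is the correction of [gam] that squares to zero; it keeps [d h = d gam]. *)
Let h n : ahom (C n) (C (n + 1)) :=
  gam n - acomp (d (n + 1)) (acomp (gam (n + 1)) (gam n)).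

Let dd n : acomp (d n) (d (n + 1)) = 0. Proof. exact: bnd_bnd. Qed.

Let dh n : acomp (d n) (h n) = acomp (d n) (gam n).
Proof. by rewrite /h acompBr (acomp_assoc (d n)) dd acomp0l subr0. Qed.

Let hdh n : acomp (h n) (acomp (d n) (h n)) = h n.
Proof. by rewrite dh /h acompBl -!acomp_assoc gam_quasi. Qed.

Let hh n : acomp (h (n + 1)) (h n) = 0.
Proof.
have gh : acomp (gam (n + 1)) (h n) = 0.
  by rewrite /h acompBr (acomp_assoc (d _)) acomp_assoc gam_quasi subrr.
by rewrite {1}/h acompBl -!acomp_assoc gh !acomp0r subrr.
Qed.

(** With [h] as above, [d h] and [h d] are idempotents annihilating each other
  ([d d = 0], [h h = 0], [h d h = h]), so [e = 1 - d h - h d] is idempotent; and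
  since [d h = d gam], it replaces [d] by [d - d gam d] on either side. *)
Lemma reduction_idempotent : exists e : forall n, ahom (C n) (C n),
  [/\ forall n, acomp (e n) (e n) = e n,
      forall n, acomp (e n) (d n) = d n - acomp (d n) (acomp (gam n) (d n)),
      forall n, acomp (d n) (e (n + 1)) =
        d n - acomp (d n) (acomp (gam n) (d n)) &
      forall n, aidm _ - e (n + 1) =
        acomp (d (n + 1)) (h (n + 1)) + acomp (h n) (d n)].
Proof.
have [e he] := shift_family
  (X := fun n => ahom (C n) (C n))
  (fun n => aidm _ - (acomp (d (n + 1)) (h (n + 1)) + acomp (h n) (d n))).
have dhd n : acomp (d n) (acomp (h n) (d n)) =
    acomp (d n) (acomp (gam n) (d n)).
  by rewrite !acomp_assoc dh.
have ed n : acomp (e n) (d n) = d n - acomp (d n) (acomp (gam n) (d n)).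
  rewrite -[n](subrK 1) he acompBl acomp_idl acompDl -!acomp_assoc dhd.
  by rewrite dd acomp0r addr0.
have de n : acomp (d n) (e (n + 1)) = d n - acomp (d n) (acomp (gam n) (d n)).
  rewrite he acompBr acomp_idr acompDr dhd.
  by rewrite (acomp_assoc (d n) (d _)) dd acomp0l add0r.
exists e; split=> //; last by move=> n; rewrite he subKr.
move=> n; rewrite -[n](subrK 1); set m := n - 1.
have eh k : acomp (e (k + 1)) (h k) = 0.
  rewrite he acompBl acomp_idl acompDl -!acomp_assoc hh acomp0r add0r.
  by rewrite hdh subrr.
rewrite [X in acomp _ X]he acompBr acomp_idr acompDr !acomp_assoc eh acomp0l.
rewrite ed acompBl -!acomp_assoc dh.
have -> : acomp (d (m + 1)) (acomp (gam (m + 1))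
   (acomp (d (m + 1)) (gam (m + 1)))) = acomp (d (m + 1)) (gam (m + 1)).
  by rewrite gam_quasi.
by rewrite subrr addr0 subr0.
Qed.

(** The splitting maps of [e] are chain maps for the compressed boundary
  [r d s]. One composite is the identity, the other is [e], which [h] contracts
  to the identity. *)
Lemma reduction (splitA : idempotents_split A) :
  exists (D : chain_complex A) (r : forall n, ahom (C n) (D n))
         (s : forall n, ahom (D n) (C n)),
    (forall n, bnd D n =
       acomp (r n) (acomp (d n - acomp (d n) (acomp (gam n) (d n))) (s (n + 1))))
    /\ isomorphic (D : K_cat A) C.
Proof.
have [e [ee ed de eh]] := reduction_idempotent.
have /dependent_choice[X /dependent_choice[r]] n := splitA _ _ (ee n).
move=> /dependent_choice[s hrs].
have rs n : acomp (r n) (s n) = aidm _ by case: (hrs n).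
have sr n : acomp (s n) (r n) = e n by case: (hrs n).
have es n : acomp (e n) (s n) = s n by rewrite -sr -acomp_assoc rs acomp_idr.
have re n : acomp (r n) (e n) = r n by rewrite -sr acomp_assoc rs acomp_idl.
pose b n := acomp (r n) (acomp (d n) (s (n + 1))).
have s_b n : acomp (s n) (b n) = acomp (d n) (s (n + 1)).
  by rewrite /b acomp_assoc sr acomp_assoc ed -de -acomp_assoc es.
have r_d n : acomp (r n) (d n) = acomp (b n) (r (n + 1)).
  by rewrite /b -!acomp_assoc sr de -ed (acomp_assoc (r n)) re.
have bb n : acomp (b n) (b (n + 1)) = 0.
  by rewrite {1}/b -!acomp_assoc s_b (acomp_assoc (d n)) dd acomp0l acomp0r.
exists (ChainComplex bb), r, s; split.
  by move=> n /=; rewrite -ed -acomp_assoc (acomp_assoc (r n)) re.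
exists (ChainMap (C := ChainComplex bb) (D := C) s_b : hom (_ : K_cat A) _).
exists (ChainMap (C := C) (D := ChainComplex bb) r_d : hom (_ : K_cat A) _).
split; first by apply: homotopic_eq => n /=; exact: rs.
by apply: homotopic_sym; exists h => n /=; rewrite sr eh.
Qed.

End Reduction.

(** [g v] is the quasi-inverse of [f] obtained from the quasi-inverse [g] of [f0]
  by the perturbation series [g - g (f - f0) g + ...], summed to [g u^-1] with
  [u = 1 + (f - f0) g]. *)
Lemma perturbed_quasi_inverse (x y : A) (f f0 : ahom x y) (g : ahom y x)
    (v : ahom y y) :
  acomp g (acomp f0 g) = g ->
  acomp (aidm y + acomp (f - f0) g) v = aidm y ->
  acomp v (aidm y + acomp (f - f0) g) = aidm y ->
  acomp (acomp g v) (acomp f (acomp g v)) = acomp g v.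
Proof.
move=> gfg uv vu; set u := aidm y + _ in uv vu.
(* [u] fixes [1 - f0 g], hence so does its inverse, and [g] kills it. *)
have u_fix : acomp u (aidm y - acomp f0 g) = aidm y - acomp f0 g.
  rewrite /u acompDl acomp_idl -acomp_assoc acompBr acomp_idr gfg subrr.
  by rewrite acomp0r addr0.
have v_fix : acomp v (aidm y - acomp f0 g) = aidm y - acomp f0 g.
  by rewrite -{1}u_fix acomp_assoc vu acomp_idl.
have fgE : acomp f g = u - (aidm y - acomp f0 g).
  by rewrite /u acompBl opprB addrA -(addrA (aidm y)) subrK addrC addKr.
have gvfg : acomp g (acomp v (acomp f g)) = g.
  by rewrite fgE acompBr vu v_fix opprB addrCA subrr addr0.
by rewrite (acomp_assoc f) -acomp_assoc (acomp_assoc v) acomp_assoc gvfg.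
Qed.

End IdempotentReduction.

(** * Filtered vector spaces *)

Section FilteredIdempotents.
Context {d : Order.disp_t} (L : finTBDistrLatticeType d) (K : fieldType).

(** The image of [e] is filtered by the images [e (f a)], which are also the
  traces of the [f a], as [e] is filtered. The first description is compatible
  with joins, the second with meets. *)
Lemma FVect_idempotents_split : idempotents_split (FVect L K).
Proof.
move=> V e ee; have {}ee v : fl_fun e (fl_fun e v) = fl_fun e v.
  have /(congr1 (fun g : fl_hom V V => fl_fun g v)) /= := ee.
  by rewrite comp_lfunE.
pose U := limg (fl_fun e).
pose s : 'Hom(subvs_of U, V) := linfun vsval.
pose r : 'Hom(V, subvs_of U) := (linfun (vsproj U) \o fl_fun e)%VF.
have sE w : s w = vsval w by rewrite lfunE.
have sr v : s (r v) = fl_fun e v.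
  by rewrite sE comp_lfunE lfunE /= vsprojK // memv_img ?memvf.
have rs w : r (s w) = w.
  have /memv_imgP[v _ ev] := subvsP w.
  by rewrite comp_lfunE lfunE /= sE ev ee -ev vsvalK.
have memr a w : (w \in r @: fl_filt V a)%VS = (s w \in fl_filt V a).
  apply/memv_imgP/idP => [[v va ->] | sa]; last by exists (s w).
  by rewrite sr (fl_filteredP _ (fl_funP e)).
pose g a := (r @: fl_filt V a)%VS.
have g_bot : g \bot%O = 0%VS by rewrite /g fl_filt_bot limg0.
have g_top : g \top%O = fullv.
  apply/eqP; rewrite eqEsubv subvf; apply/subvP => w _.
  by rewrite memr fl_filt_top memvf.
have g_meet a b : g (a `&` b)%O = (g a :&: g b)%VS.
  by apply/vspaceP => w; rewrite memv_cap !memr fl_filt_meet memv_cap.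
have g_join a b : g (a `|` b)%O = (g a + g b)%VS.
  by rewrite /g fl_filt_join limgD.
pose W : FVect L K := FilteredVect g_bot g_top g_meet g_join.
have r_filt : (r : 'Hom(V, fl_space W)) \in fl_filtered V W.
  by apply/fl_filteredP => a v va; apply: memv_img.
have s_filt : (s : 'Hom(fl_space W, V)) \in fl_filtered W V.
  by apply/fl_filteredP => a w; rewrite /= memr.
exists W, (FlHom r_filt), (FlHom s_filt); split; apply: val_inj; apply/lfunP => v.
  by rewrite /= comp_lfunE rs id_lfunE.
by rewrite /= comp_lfunE sr.
Qed.

(** An injective filtered endomorphism maps each [f a] onto itself, for reasons of
  dimension. *)
Lemma fl_inverse_filtered (V : filtered_vect L K) (u : 'End(V)) :
  u \in fl_filtered V V -> lker u == 0%VS -> (u^-1)%VF \in fl_filtered V V.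
Proof.
move=> /fl_filteredP uV ku; apply/fl_filteredP => a v va.
have uaE : (u @: fl_filt V a)%VS = fl_filt V a.
  apply/eqP; rewrite eqEdim limg_dim_eq ?(eqP ku) ?capv0 // leqnn andbT.
  by apply/subvP => _ /memv_imgP[w wa ->]; apply: uV.
move: va; rewrite -{1}uaE => /memv_imgP[w wa ->].
by rewrite (lker0_lfunK ku).
Qed.

End FilteredIdempotents.

(** * Filtrations by down-sets are gradings *)

Section DownSetFiltrations.
Context {d : Order.disp_t} (P : finPOrderType d) (K : fieldType).

Lemma below_subproof (p : P) : is_downset [set q | (q <= p)%O].
Proof. by apply/is_downsetP => q r; rewrite !inE => rp qr; apply: le_trans rp. Qed.

Lemma strictly_below_subproof (p : P) : is_downset [set q | (q < p)%O].
Proof.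
by apply/is_downsetP => q r; rewrite !inE => rp qr; apply: le_lt_trans rp.
Qed.

Definition below p : downset P := DownSet (below_subproof p).
Definition strictly_below p : downset P := DownSet (strictly_below_subproof p).

Lemma downset_maximal (a : downset P) : dset a != set0 ->
  exists2 p, p \in dset a & forall q, q \in dset a -> ~~ (p < q)%O.
Proof.
move=> /set0Pn[p0 ap0].
case: (arg_maxnP (fun p => #|dset (below p)|) ap0) => p ap pmax.
exists p => // q aq; apply/negP => pq.
have := pmax q aq; rewrite /= leqNgt => /negP[].
apply: proper_card; apply/properP; split.
  by apply/subsetP => r; rewrite !inE => rp; apply: le_trans rp (ltW pq).
by exists q; rewrite !inE // lt_geF.
Qed.

Lemma downset_del_subproof (a : downset P) (p : P) :
  (forall q, q \in dset a -> ~~ (p < q)%O) -> is_downset (dset a :\ p).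
Proof.
move=> pmax; apply/is_downsetP => q r; rewrite !inE => /andP[rp ra] qr.
rewrite (is_downsetP _ (dsetP a) _ _ ra qr) andbT.
apply: contra (pmax r ra) => /eqP qp.
by rewrite lt_neqAle eq_sym rp -qp qr.
Qed.

Section Grading.
Variable V : filtered_vect (downset P) K.
Let f := fl_filt V.

Lemma fl_filt_sub (a b : downset P) : dset a \subset dset b -> (f a <= f b)%VS.
Proof.
move=> ab; have <- : (a `&` b)%O = a by apply/val_inj/setIidPl.
by rewrite /f fl_filt_meet capvSr.
Qed.

Definition fl_piece (p : P) : {vspace V} :=
  (f (below p) :\: f (strictly_below p))%VS.

Lemma fl_piece_add p : (f (strictly_below p) + fl_piece p)%VS = f (below p).
Proof.
rewrite addvC addv_diff; apply/addv_idPl/fl_filt_sub.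
by apply/subsetP => q; rewrite !inE => /ltW.
Qed.

Lemma dim_fl_piece p :
  \dim (f (below p)) = (\dim (f (strictly_below p)) + \dim (fl_piece p))%N.
Proof. by rewrite -fl_piece_add dimv_disjoint_sum // capvC capv_diff. Qed.

(** Remove a maximal element [p] of [a]: the remaining down-set [a'] and the
  principal down-set of [p] have union [a] and intersection [{q | q < p}], so the
  lattice homomorphism property says that [f a] is [f a'] plus the piece at [p],
  and the dimension formula that this sum is direct. *)
Lemma fl_filt_pieces (a : downset P) :
  f a = (\sum_(p in dset a) fl_piece p)%VS /\
  \dim (f a) = (\sum_(p in dset a) \dim (fl_piece p))%N.
Proof.
have [n] := ubnP #|dset a|; elim: n a => // n IHn a.
have [a0 _|/downset_maximal[p ap pmax]] := eqVneq (dset a) set0.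
  have -> : a = \bot%O by apply: val_inj.
  by rewrite /f fl_filt_bot dimv0 !big_pred0 // => p; rewrite inE.
pose a' := DownSet (downset_del_subproof pmax).
have aE : a = (a' `|` below p)%O.
  apply: val_inj; apply/setP => q; rewrite !inE /=.
  case: eqVneq => [->|_] /=; first by rewrite lexx ap.
  apply/idP/orP => [qa|[//|qp]]; first by left.
  exact: (is_downsetP _ (dsetP a) _ _ ap qp).
have a'I : (a' `&` below p)%O = strictly_below p.
  apply: val_inj; apply/setP => q; rewrite !inE /= lt_neqAle.
  case: eqVneq => //= _; apply: andb_idl => qp.
  exact: (is_downsetP _ (dsetP a) _ _ ap qp).
rewrite (cardsD1 p) ap ltnS => a'n; have [fa' dimfa'] := IHn a' a'n.
have s_a' : (f (strictly_below p) <= f a')%VS.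
  by rewrite -a'I /f fl_filt_meet capvSl.
split.
  rewrite (big_setD1 p) //= -[X in (_ + X)%VS]fa' [LHS]/f.
  rewrite {1}aE /f fl_filt_join -/f -fl_piece_add addvA.
  by rewrite (addv_idPl s_a') addvC.
rewrite (big_setD1 p) //= -[X in (_ + X)%N]dimfa'.
apply/eqP; rewrite -(eqn_add2r (\dim (f (strictly_below p)))).
rewrite {1}aE /f fl_filt_join -{1}a'I fl_filt_meet -/f dimv_sum_cap dim_fl_piece.
by rewrite addnC -addnA addnC -addnA addnCA.
Qed.

Lemma fl_pieces_full : fullv = (\sum_p fl_piece p)%VS.
Proof.
have [fT _] := fl_filt_pieces \top%O.
by rewrite -(fl_filt_top V) -/f fT; apply: eq_bigl => p; rewrite inE.
Qed.

Lemma fl_pieces_direct : directv (\sum_p fl_piece p).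
Proof.
have [_ dT] := fl_filt_pieces \top%O.
rewrite directvE /= -fl_pieces_full -(fl_filt_top V) -/f dT.
by apply/eqP; apply: eq_bigl => p; rewrite inE.
Qed.

Let pi (p : P) : 'End(V) := sumv_pi_for fl_pieces_full p.

Lemma fl_proj_mem p v : pi p v \in fl_piece p.
Proof. exact: memv_sum_pi. Qed.

Lemma fl_proj_sum v : \sum_p pi p v = v.
Proof. by apply: sumv_pi_sum; apply: memvf. Qed.

Lemma fl_proj_piece p q v : v \in fl_piece q -> pi p v = if p == q then v else 0.
Proof.
move=> vq; pose us i := pi i v; pose vs i : V := if i == q then v else 0.
have sum_us_vs : \sum_i us i = \sum_i vs i.
  by rewrite fl_proj_sum (bigD1 q) //= /vs eqxx big1 ?addr0 // => i /negPf->.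
have := directv_sum_unique fl_pieces_direct us vs.
rewrite sum_us_vs eqxx => h; apply/eqP; move: p (isT : true).
apply/forall_inP; rewrite -h // => i _; first exact: fl_proj_mem.
by rewrite /vs; case: eqVneq => [->|_] //; rewrite mem0v.
Qed.

Lemma limg_fl_proj p : limg (pi p) = fl_piece p.
Proof.
apply/vspaceP => v; apply/memv_imgP/idP => [[w _ ->] | vp].
  exact: fl_proj_mem.
by exists v; rewrite ?memvf // (fl_proj_piece _ vp) eqxx.
Qed.

(** The projections onto the pieces grade the same underlying space and recover
  the filtration exactly, so the isomorphism is the identity map. *)
Lemma fl_grading_exists : exists W : graded_vect P K,
  aisomorphic (gr_to_fl P K W) (V : FVect (downset P) K).
Proof.
have pi_idem p : (pi p \o pi p)%VF = pi p.
  apply/lfunP => v; rewrite comp_lfunE.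
  by rewrite (fl_proj_piece _ (fl_proj_mem p v)) eqxx.
have pi_orth p q : p != q -> (pi p \o pi q)%VF = 0.
  move=> pq; apply/lfunP => v; rewrite comp_lfunE zero_lfunE.
  by rewrite (fl_proj_piece _ (fl_proj_mem q v)) (negPf pq).
have pi_sum : \sum_p pi p = \1%VF.
  by apply/lfunP => v; rewrite sum_lfunE fl_proj_sum id_lfunE.
pose W := GradedVect pi_idem pi_orth pi_sum; exists W.
have WE a : fl_filt (gr_to_fl_obj W) a = f a.
  have [-> _] := fl_filt_pieces a.
  by apply: eq_bigr => p _; apply: limg_fl_proj.
have idWV : (\1%VF : 'Hom(gr_to_fl_obj W, V)) \in fl_filtered (gr_to_fl_obj W) V.
  by apply/fl_filteredP => a v; rewrite id_lfunE WE.
have idVW : (\1%VF : 'Hom(V, gr_to_fl_obj W)) \in fl_filtered V (gr_to_fl_obj W).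
  by apply/fl_filteredP => a v; rewrite id_lfunE WE.
exists (FlHom idWV), (FlHom idVW).
by split; apply: val_inj; rewrite /= comp_lfun1l.
Qed.

End Grading.

(** [V^q] lies in the subspace of [{r | r <= q}], so its image under a filtered
  map has no component at [p] unless [p <= q]. *)
Lemma gr_to_fl_full : afull (gr_to_fl P K).
Proof.
move=> V W phi.
have phi_gr : (fl_fun phi : 'Hom(gr_space V, gr_space W)) \in gr_filtered V W.
  apply/gr_filteredP => p q npq; apply/lfunP => v.
  rewrite /gr_entry !comp_lfunE zero_lfunE.
  have /(fl_filteredP _ (fl_funP phi)) /gr_sumP :
      (gr_proj V q v : fl_space (gr_to_fl_obj V)) \in gr_sum V (below q).
    by apply/gr_sumP => r; rewrite inE gr_projE; case: eqVneq => // ->; rewrite lexx.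
  by apply; rewrite inE.
by exists (GrHom phi_gr : ahom V W); apply: val_inj.
Qed.

Lemma gr_to_fl_faithful : afaithful (gr_to_fl P K).
Proof.
move=> V W phi psi /(congr1 (@fl_fun _ _ _ _ _)) /= e.
exact: val_inj.
Qed.

Lemma gr_to_fl_essentially_surjective : aessentially_surjective (gr_to_fl P K).
Proof. exact: fl_grading_exists. Qed.

Lemma GrVect_idempotents_split : idempotents_split (GrVect P K).
Proof.
apply: (idempotents_split_reflect gr_to_fl_full gr_to_fl_faithful).
  exact: gr_to_fl_essentially_surjective.
exact: FVect_idempotents_split.
Qed.

End DownSetFiltrations.

(** * Strict representatives of graded complexes *)

Section Strictification.
Context {d : Order.disp_t} (P : finPOrderType d) (K : fieldType).
Implicit Types U V W : graded_vect P K.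

Lemma gr_proj_decomp V (v : V) : \sum_p gr_proj V p v = v.
Proof. by rewrite -sum_lfunE gr_proj_sum id_lfunE. Qed.

Lemma gr_entryD V W (f g : 'Hom(V, W)) p q :
  gr_entry (f + g) p q = gr_entry f p q + gr_entry g p q.
Proof. by rewrite /gr_entry comp_lfunDl comp_lfunDr. Qed.

Lemma gr_entryB V W (f g : 'Hom(V, W)) p q :
  gr_entry (f - g) p q = gr_entry f p q - gr_entry g p q.
Proof.
by rewrite /gr_entry comp_lfunDl comp_lfunDr comp_lfunNl comp_lfunNr.
Qed.

Lemma gr_entry_id V p : gr_entry (\1%VF : 'End(V)) p p = gr_proj V p.
Proof. by rewrite /gr_entry comp_lfun1l gr_proj_idem. Qed.

(** In [g^(pr) f^(rp)] both factors are nonzero only if [p <= r <= p]. *)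
Lemma gr_entry_comp_diag U V W (g : gr_hom V W) (f : gr_hom U V) p :
  gr_entry (g \o f)%VF p p = (gr_entry g p p \o gr_entry f p p)%VF.
Proof.
rewrite gr_entry_comp (bigD1 p) //= big1 ?addr0 // => r rp.
have [pr|npr] := boolP (p <= r)%O; last first.
  by rewrite (gr_filteredP _ (gr_funP g)) // comp_lfun0l.
rewrite (gr_filteredP _ (gr_funP f)) ?comp_lfun0r //.
by apply: contra rp => rp; rewrite eq_le rp pr.
Qed.

(** Back-substitution in a triangular system, from the top of the poset down: if
  the components of [v] above [p] vanish, the component of [u v] at [p] is that
  of [v]. *)
Lemma gr_unipotent_injective V (u : gr_hom V V) :
  (forall p, gr_entry u p p = gr_proj V p) -> lker (gr_fun u) == 0%VS.
Proof.
move=> u1; rewrite -subv0; apply/subvP => v; rewrite memv_ker memv0 => /eqP uv0.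
suff v0 p : gr_proj V p v = 0 by rewrite -(gr_proj_decomp v) big1.
have [n] := ubnP #|[set q | (p < q)%O]|; elim: n p => // n IHn p; rewrite ltnS => pn.
have: gr_proj V p (gr_fun u v) = 0 by rewrite uv0 linear0.
rewrite -{1}(gr_proj_decomp v) !linear_sum (bigD1 p) //= big1 ?addr0 => [|q qp].
  by have /lfunP/(_ v) := u1 p; rewrite /gr_entry !comp_lfunE => ->.
have [pq|npq] := boolP (p <= q)%O; last first.
  have /lfunP/(_ v) := gr_filteredP _ (gr_funP u) p q npq.
  by rewrite /gr_entry !comp_lfunE zero_lfunE.
rewrite (IHn q) ?linear0 //; apply: leq_trans pn; apply: proper_card.
have {}pq : (p < q)%O by rewrite lt_neqAle eq_sym qp.
apply/properP; split; last by exists q; rewrite !inE ?ltxx.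
by apply/subsetP => r; rewrite !inE; apply: lt_trans.
Qed.

Lemma gr_unipotent_unit (V : GrVect P K) (u : ahom V V) :
  (forall p, gr_entry (gr_fun u) p p = gr_proj V p) ->
  exists v : ahom V V, [/\ acomp u v = aidm V, acomp v u = aidm V &
    forall p, gr_entry (gr_fun v) p p = gr_proj V p].
Proof.
move=> u1; have ku := gr_unipotent_injective u1.
have u_fl := gr_to_fl_subproof u.
have v_fl := fl_inverse_filtered u_fl ku.
have [v /(congr1 (@fl_fun _ _ _ _ _)) vE] :=
  gr_to_fl_full (FlHom v_fl : ahom (gr_to_fl P K V) (gr_to_fl P K V)).
rewrite /= in vE.
have uv : acomp u v = aidm V.
  by apply: val_inj; rewrite /= vE lker0_compfV.
exists v; split=> // [|p].
  by apply: val_inj; rewrite /= vE lker0_compVf.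
have := gr_entry_comp_diag u v p; rewrite u1.
have -> : (gr_fun u \o gr_fun v)%VF = \1%VF.
  by have /(congr1 (@gr_fun _ _ _ _ _)) := uv.
by rewrite gr_entry_id /gr_entry !comp_lfunA gr_proj_idem => /esym.
Qed.

Definition gr_diag V W (f : 'Hom(V, W)) : 'Hom(V, W) := \sum_p gr_entry f p p.

Lemma gr_diagE V W (f : 'Hom(V, W)) v :
  gr_diag f v = \sum_p gr_proj W p (f (gr_proj V p v)).
Proof. by rewrite sum_lfunE; apply: eq_bigr => p _; rewrite !comp_lfunE. Qed.

Lemma gr_proj_diag V W (f : 'Hom(V, W)) p v :
  gr_proj W p (gr_diag f v) = gr_proj W p (f (gr_proj V p v)).
Proof.
rewrite gr_diagE linear_sum (bigD1 p) //= gr_projE eqxx big1 ?addr0 // => q qp.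
by rewrite gr_projE eq_sym (negPf qp).
Qed.

Lemma gr_diag_proj V W (f : 'Hom(V, W)) p v :
  gr_diag f (gr_proj V p v) = gr_proj W p (f (gr_proj V p v)).
Proof.
rewrite gr_diagE (bigD1 p) //= gr_projE eqxx big1 ?addr0 // => q qp.
by rewrite gr_projE (negPf qp) !linear0.
Qed.

Lemma gr_diag_filtered V W (f : 'Hom(V, W)) : gr_diag f \in gr_filtered V W.
Proof.
apply/gr_filteredP => p q npq; apply/lfunP => v.
rewrite /gr_entry !comp_lfunE zero_lfunE gr_diag_proj gr_projE.
by case: eqVneq npq => // ->; rewrite lexx.
Qed.

Lemma gr_entry_diag V W (f : 'Hom(V, W)) p :
  gr_entry (gr_diag f) p p = gr_entry f p p.
Proof.
apply/lfunP => v; rewrite /gr_entry !comp_lfunE.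
by rewrite gr_proj_diag gr_projE eqxx.
Qed.

(** [f0] commutes with the projections, so replacing its pseudo-inverse by the
  diagonal part of it does not affect [f0 f0^-1 f0 = f0]. *)
Lemma gr_diag_quasi_inverse V W (f : 'Hom(V, W)) (f0 := gr_diag f) :
  (f0 \o (gr_diag f0^-1 \o f0))%VF = f0.
Proof.
have f0_proj p v : f0 (gr_proj V p v) = gr_proj W p (f0 v).
  by rewrite gr_diag_proj gr_proj_diag.
apply/lfunP => v; rewrite !comp_lfunE (gr_diagE (f0^-1)%VF) linear_sum /=.
under eq_bigr => p _ do rewrite f0_proj -(f0_proj p v) limg_lfunVK ?memv_img ?memvf //
  f0_proj gr_projE eqxx.
exact: gr_proj_decomp.
Qed.

(** A quasi-inverse [g1] of the diagonal part [f0] in the weak sense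
  [f0 g1 f0 = f0] is first improved to [g = g1 f0 g1], which also satisfies
  [g f0 g = g], and then perturbed into a quasi-inverse of [f]. As the
  perturbation has identity diagonal, the diagonal of [f g f] is still that of
  [f0 g f0 = f0], i.e. of [f]. *)
Lemma gr_quasi_inverse_mod_strict (V W : GrVect P K) (f : ahom V W) :
  exists g : ahom W V, acomp g (acomp f g) = g /\
    forall p, gr_entry (gr_fun (f - acomp f (acomp g f))) p p = 0.
Proof.
pose f0 : ahom V W := GrHom (gr_diag_filtered (gr_fun f)).
pose g1 : ahom W V := GrHom (gr_diag_filtered (gr_fun f0)^-1%VF).
have f0g1f0 : acomp f0 (acomp g1 f0) = f0.
  by apply: val_inj; apply: gr_diag_quasi_inverse.
pose g := acomp g1 (acomp f0 g1).
have f0gf0 : acomp f0 (acomp g f0) = f0.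
  by rewrite /g -!acomp_assoc f0g1f0 f0g1f0.
have gf0g : acomp g (acomp f0 g) = g.
  have gf0 : acomp g f0 = acomp g1 f0 by rewrite /g -!acomp_assoc f0g1f0.
  by rewrite acomp_assoc gf0 /g -acomp_assoc (acomp_assoc f0)
    (acomp_assoc (acomp f0 g1)) -(acomp_assoc f0 g1 f0) f0g1f0.
pose u : ahom W W := aidm W + acomp (f - f0) g.
have u1 p : gr_entry (gr_fun u) p p = gr_proj W p.
  rewrite [gr_fun u]/= gr_entryD gr_entry_id (gr_entry_comp_diag (f - f0) g).
  by rewrite [gr_fun (f - f0)]/= gr_entryB gr_entry_diag subrr comp_lfun0l addr0.
have [v [uv vu v1]] := gr_unipotent_unit u1.
exists (acomp g v); split; first exact: perturbed_quasi_inverse gf0g uv vu.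
move=> p; rewrite [gr_fun _]/= gr_entryB.
have -> : gr_entry (gr_fun f \o (gr_fun g \o gr_fun v \o gr_fun f))%VF p p =
          gr_entry (gr_fun (acomp f0 (acomp g f0))) p p.
  rewrite (gr_entry_comp_diag f (acomp (acomp g v) f)).
  rewrite (gr_entry_comp_diag (acomp g v) f) (gr_entry_comp_diag g v) v1.
  rewrite (gr_entry_comp_diag f0 (acomp g f0)) (gr_entry_comp_diag g f0).
  rewrite gr_entry_diag; congr (_ \o (_ \o _))%VF.
  by rewrite /gr_entry -!comp_lfunA gr_proj_idem.
by rewrite f0gf0 gr_entry_diag subrr.
Qed.

Lemma strict_representative (C : K_cat (GrVect P K)) :
  exists C' : K_cat (GrVect P K), strict C' /\ isomorphic C' C.
Proof.
have /dependent_choice[gam hgam] n :=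
  gr_quasi_inverse_mod_strict (bnd (C : chain_complex _) n).
have gam_quasi n : acomp (gam n) (acomp (bnd C n) (gam n)) = gam n.
  by case: (hgam n).
have [C' [r [s [bndC' C'C]]]] := reduction gam_quasi (@GrVect_idempotents_split _ P K).
exists C'; split=> // n p; rewrite bndC'; have [_ hn] := hgam n.
set x := _ - _ in hn *.
rewrite (gr_entry_comp_diag (r n) (acomp x (s (n + 1)))).
by rewrite (gr_entry_comp_diag x (s (n + 1))) hn comp_lfun0l comp_lfun0r.
Qed.

Lemma Ks_inclusion_essentially_surjective :
  essentially_surjective (Ks_inclusion P K).
Proof.
move=> C; have [C' [sC' C'C]] := strict_representative C.
by exists (exist _ C' sC').
Qed.

End Strictification.

(** * Conley functors *)

Theorem corollary8p3 (d : Order.disp_t) (P : finPOrderType d) (K : fieldType) :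
  (exists F : functor (K_cat (GrVect P K)) (Ks_GrVect P K),
     inverse_equivalences F (Ks_inclusion P K) /\
     (forall C : K_cat (GrVect P K), gr_conley_complex C (F C)))
  /\
  (exists G : functor (K_cat (FVect (downset P) K)) (Ks_GrVect P K),
     inverse_equivalences G (functor_comp (gr_to_fl_K P K) (Ks_inclusion P K)) /\
     (forall C : K_cat (FVect (downset P) K), fl_conley_complex C (G C))).
Proof.
have fullL := @gr_to_fl_full _ P K; have faithL := @gr_to_fl_faithful _ P K.
have esL := @gr_to_fl_essentially_surjective _ P K.
have full_i : full (Ks_inclusion P K) by apply: inclusion_full.
have faith_i : faithful (Ks_inclusion P K) by apply: inclusion_faithful.
have es_i := @Ks_inclusion_essentially_surjective _ P K.
split; first exact: inverse_equivalence_exists.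
apply: inverse_equivalence_exists.
- exact: full_comp full_i (K_functor_full fullL faithL).
- exact: faithful_comp faith_i (K_functor_faithful fullL faithL).
- apply: essentially_surjective_comp es_i _.
  exact: K_functor_essentially_surjective fullL faithL esL.
Qed.
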